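(* Fix an integer $n \geq 3$. There is a function $g:\mathbb{N}\to\mathbb{R}_{\ge 0}$ with $g(q)/q \to 0$ as $q\to\infty$ such that, for all sufficiently large $q$, \[ f(n,q) \;\geq\; \mathrm{tw}_q\big(n-1,\; q-g(q)\big), \] i.e. $f(n,q)$ is at least a tower $q^{q^{\cdot^{\cdot^{q^{x}}}}}$ containing $n-1$ levels in total, whose topmost exponent is $x=q-g(q)$.
   Context: A word over an alphabet is a finite string of letters; a subword of $w$ is a string of consecutive letters of $w$. A word $w$ contains a pattern $P$ (a word over a separate alphabet of variables) if there is a map assigning to each letter of $P$ a nonempty word (different letters may receive equal words) such that the word obtained from $P$ by replacing each letter by its assigned word is a subword of $w$; otherwise $w$ avoids $P$. The Zimin words are defined by $Z_1=x_1$ and $Z_n=Z_{n-1}x_nZ_{n-1}$, where $x_n$ is a new letter (so $Z_2=x_1x_2x_1$, $Z_3=x_1x_2x_1x_3x_1x_2x_1$). For positive integers $n,q$, $f(n,q)$ denotes the smallest integer such that every word of length $f(n,q)$ over an alphabet of size $q$ contains $Z_n$. Tower notation: $\mathrm{tw}_q(1,x)=x$ and $\mathrm{tw}_q(k+1,x)=q^{\mathrm{tw}_q(k,x)}$; so $\mathrm{tw}_q(2,x)=q^x$, $\mathrm{tw}_q(3,x)=q^{q^x}$, etc. *)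

(* Defs.v *)
From mathcomp Require Import all_boot all_order all_algebra.
From mathcomp Require Import all_classical all_reals all_analysis.

Set Implicit Arguments.
Unset Strict Implicit.
Unset Printing Implicit Defensive.

Import Order.TTheory GRing.Theory Num.Theory.

Section Patterns.
Variables V A : eqType.

Definition subst_word (h : V -> seq A) (P : seq V) : seq A :=
  flatten [seq h x | x <- P].

Definition contains (P : seq V) (w : seq A) : Prop :=
  exists h : V -> seq A,
    {in P, forall x, h x <> [::]} /\ infix (subst_word h P) w.

End Patterns.

(* The variable x_i is encoded as the natural number i.-1, and zimin 0 is the
   empty word, so that zimin 1 = [:: 0]. *)
Fixpoint zimin (n : nat) : seq nat :=
  if n is m.+1 then zimin m ++ m :: zimin m else [::].

Definition zimin_forced (n q N : nat) : Prop :=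
  forall w : seq 'I_q, size w = N -> contains (zimin n) w.

Lemma mem_zimin n x : x \in zimin n -> (x < n)%N.
Proof.
elim: n => [//|n IHn] /=; rewrite mem_cat inE.
case/orP => [/IHn /ltnW//|/orP[/eqP-> //|/IHn /ltnW//]].
Qed.

Lemma contains_zimin_sandwich (A : eqType) n (p u v s : seq A) :
  v <> [::] -> contains (zimin n) u ->
  contains (zimin n.+1) (p ++ u ++ v ++ u ++ s).
Proof.
move=> v0 [h [h0 /infixP [a [b ->]]]].
pose h' x := if x == n then b ++ v ++ a else h x.
have hE x : x \in zimin n -> h' x = h x.
  by move=> /mem_zimin; rewrite /h'; case: eqVneq => // ->; rewrite ltnn.
have sE : subst_word h' (zimin n) = subst_word h (zimin n).
  by congr flatten; apply/eq_in_map.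
exists h'; split.
  move=> x; rewrite /= mem_cat inE.
  have h'0 : x \in zimin n -> h' x <> [::].
    by move=> xn; rewrite hE //; apply: h0.
  case/orP => [/h'0//|/orP[/eqP ->|/h'0//]].
  by rewrite /h' eqxx; case: (b) => //; case: (v) v0.
apply/infixP; exists (p ++ a), (b ++ s).
have -> : subst_word h' (zimin n.+1) =
    subst_word h (zimin n) ++ (b ++ v ++ a) ++ subst_word h (zimin n).
  rewrite /subst_word /= map_cat flatten_cat /= -!/(subst_word _ _).
  by rewrite sE /h' eqxx.
by rewrite -!catA.
Qed.

Lemma zimin_forced_large n q :
  exists N, forall w : seq 'I_q, (N <= size w)%N -> contains (zimin n) w.
Proof.
elim: n => [|n [N IHn]].
  by exists 0%N => w _; exists (fun=> [::]); split=> //; exact: infix0s.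
set M := #|{: N.-tuple 'I_q}|.
exists (M.+1 * N.+1)%N => w szw.
have szB (i : 'I_M.+1) : size (take N (drop (i * N.+1) w)) == N.
  rewrite size_take_min size_drop; apply/eqP/minn_idPl.
  rewrite leq_subRL; last by apply: leq_trans szw; rewrite leq_mul2r ltnW.
  apply: leq_trans szw; apply: (@leq_trans (i.+1 * N.+1)).
    by rewrite mulSn addnC leq_add2r.
  by rewrite leq_mul2r ltn_ord orbT.
pose B i : N.-tuple 'I_q := Tuple (szB i).
have [i [j [ij Bij]]] : exists i j : 'I_M.+1, (i < j)%N /\ B i = B j.
  have /injectivePn [i [j ij Bij]] : ~~ injectiveb B.
    apply/negP => /injectiveP /leq_card; rewrite card_ord /M.
    by rewrite ltnn.
  case: (ltngtP i j) => [?|?|/val_inj /eqP]; first by exists i, j.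
    by exists j, i.
  by rewrite (negPf ij).
have {Bij} Bij : take N (drop (i * N.+1) w) = take N (drop (j * N.+1) w).
  by have := congr1 val Bij.
have le_j : (i * N.+1 + N < j * N.+1)%N.
  apply: (@leq_trans (i.+1 * N.+1)); last by rewrite leq_mul2r ij orbT.
  by rewrite mulSn addSn ltnS addnC.
set u := take N _ in Bij.
have uN : size u = N by apply/eqP/szB.
pose k := (j * N.+1 - (i * N.+1 + N))%N.
pose v := take k (drop (i * N.+1 + N) w).
have v0 : v <> [::].
  move=> /(congr1 size)/eqP; rewrite size_take_min size_drop /=.
  rewrite -leqn0 geq_min !leqn0 !subn_eq0 leqNgt le_j /= leqNgt (leq_trans le_j) //.
  by apply: leq_trans szw; rewrite leq_mul2r ltnW ?orbT.
have -> : w = take (i * N.+1) w ++ u ++ v ++ u ++ drop N (drop (j * N.+1) w).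
  rewrite {2}Bij cat_take_drop.
  have -> : drop (j * N.+1) w = drop k (drop (i * N.+1 + N) w).
    by rewrite drop_drop subnK // ltnW.
  by rewrite cat_take_drop addnC -drop_drop !cat_take_drop.
by apply: contains_zimin_sandwich => //; apply: IHn; rewrite uN.
Qed.

Lemma zimin_forced_exists n q : exists N, `[< zimin_forced n q N >].
Proof.
have [N HN] := zimin_forced_large n q.
by exists N; apply/asboolP => w szw; apply: HN; rewrite szw.
Qed.

Definition zimin_f (n q : nat) : nat := ex_minn (zimin_forced_exists n q).

Local Open Scope ring_scope.

(* tw q k x has k levels counting the topmost exponent x; only k >= 1 is
   meaningful. *)
Definition tw (R : realType) (q : R) (k : nat) (x : R) : R :=
  iter k.-1 (fun y => q `^ y) x.

(* Main.v *)
(** Call a word sparse, for a sequence [E] with [E 0 = 0], if two equal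
windows of length [(E j).+1] always lie more than [E j.+1] apart.  A copy of
[zimin j.+2] has the form [u v u] with [u] a copy of [zimin j.+1], so by
induction every copy of [zimin j.+1] in a sparse word is longer than [E j].
Sparse words exist by counting: a one-letter extension that violates the
condition for [j] at distance [t] is determined by [t] and all but [E j] letters
of the original word.  If the number of sparse words grows at least by a factor
[b] per letter and [E j.+1 = b ^ E j] then only one extension letter is lost on
average for each [j > 0], and [E 1] letters for [j = 0], so the growth hypothesis
propagates as long as [E 1 + b + n - 2 <= q].  Hence [zimin_f n q] exceeds a tower
of [n - 2] copies of [b] topped by [E 1]; with [b] about [q / e ^ sqrt (ln q)]
and [E 1 = q - b - (n - 2)] this is the required bound. *)

Require Import Defs.
From mathcomp Require Import all_boot all_order all_algebra.
From mathcomp Require Import all_classical all_reals all_analysis.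
From mathcomp Require Import zify ring lra.
Import Order.TTheory GRing.Theory Num.Theory.
Import numFieldNormedType.Exports.

Set Implicit Arguments.
Unset Strict Implicit.
Unset Printing Implicit Defensive.

(** * Copies of Zimin words in sparse words *)

Definition sparse (A : eqType) (E : nat -> nat) (r : nat) (w : seq A) : Prop :=
  forall j i t, j < r -> 0 < t <= E j.+1 -> i + t + E j < size w ->
  take (E j).+1 (drop i w) <> take (E j).+1 (drop (i + t) w).

Lemma sparse_drop (A : eqType) E r k (w : seq A) :
  sparse E r w -> sparse E r (drop k w).
Proof.
move=> sw j i t jr tE; rewrite size_drop !drop_drop => szw.
by rewrite addnAC; apply: sw => //; lia.
Qed.

Lemma zimin_copy_size (A : eqType) E r (w : seq A) (h : nat -> seq A) j :
  E 0 = 0 -> sparse E r w -> j <= r ->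
  {in zimin j.+1, forall x, h x <> [::]} ->
  infix (subst_word h (zimin j.+1)) w ->
  E j < size (subst_word h (zimin j.+1)).
Proof.
move=> E0 sw; elim: j => [|j IHj] jr h0.
  move=> _; rewrite E0 /subst_word /= cats0 lt0n size_eq0.
  by apply/eqP/h0; rewrite inE.
rewrite [zimin j.+2]/=.
have -> : subst_word h (zimin j.+1 ++ j.+1 :: zimin j.+1) =
    subst_word h (zimin j.+1) ++ h j.+1 ++ subst_word h (zimin j.+1).
  by rewrite /subst_word map_cat flatten_cat.
set u := subst_word h _; set v := h j.+1 => uvu.
have v0 : 0 < size v.
  by rewrite lt0n size_eq0; apply/eqP/h0; rewrite mem_cat !inE eqxx orbT.
have szu : E j < size u.
  apply: IHj; first exact: ltnW.
    by move=> x xj; apply: h0; rewrite /= mem_cat xj.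
  by apply: infix_trans uvu; apply: prefix_infix; apply: prefix_prefix.
rewrite !size_cat; case: (ltnP (E j.+1) (size u + size v)) => [|le_uv]; first lia.
have [p [s def_w]] := infixP uvu.
case: (sw j (size p) (size u + size v) jr); first lia.
  by rewrite def_w !size_cat; lia.
have def_w' : w = (p ++ u ++ v) ++ u ++ s by rewrite def_w !catA.
rewrite {1}def_w drop_size_cat // def_w' drop_size_cat ?size_cat //.
by rewrite -!catA !takel_cat.
Qed.

(** * Counting sparse words *)

Section Count.
Variables (q r : nat) (E : nat -> nat).

Definition sparse_words m : seq (seq 'I_q) :=
  [seq w <- [seq val t | t <- enum {: m.-tuple 'I_q}] | `[< sparse E r w >]].

Lemma mem_sparse_words m w :
  (w \in sparse_words m) = (size w == m) && `[< sparse E r w >].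
Proof.
rewrite mem_filter andbC; congr andb; apply/mapP/eqP => [[t _ ->]|szw].
  exact: size_tuple.
by exists (Tuple (introT eqP szw)) => //; rewrite mem_enum.
Qed.

Lemma sparse_words_uniq m : uniq (sparse_words m).
Proof. by rewrite filter_uniq // map_inj_uniq ?enum_uniq //; exact: val_inj. Qed.

(* A word whose first [k] letters recur at distance [t] is determined by what
   follows these letters: prepend [k] times the letter found [t] places later. *)
Definition period_cons (x0 : 'I_q) t (w : seq 'I_q) := nth x0 w t.-1 :: w.

Lemma period_consK x0 t k (w : seq 'I_q) : 0 < t -> t + k <= size w ->
  take k w = take k (drop t w) -> w = iter k (period_cons x0 t) (drop k w).
Proof.
move=> t0; elim: k w => [|k IHk] [|x w] //=; first by rewrite addnS.
rewrite addnS ltnS => szw.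
have : (x :: take k w) = take k.+1 (drop t (x :: w)) -> 
  x = nth x0 w t.-1 /\ take k w = take k (drop t w).
  case: t t0 szw {IHk} => // t _ szw /=.
  rewrite (drop_nth x0) /=; last by lia.
  by case=> <- <-.
move=> /[apply] -[xE kE]; rewrite -IHk // /period_cons -xE //.
Qed.

Lemma sparse_words_rec (x0 : 'I_q) m :
  q * size (sparse_words m) <= size (sparse_words m.+1) +
    \sum_(j < r | E j <= m) E j.+1 * size (sparse_words (m - E j)).
Proof.
pose bad j := [seq iter (E j).+1 (period_cons x0 t) s
                 | t <- iota 1 (E j.+1), s <- sparse_words (m - E j)].
pose bads := flatten [seq bad j | j <- [seq j <- index_iota 0 r | E j <= m]].
have -> : \sum_(j < r | E j <= m) E j.+1 * size (sparse_words (m - E j)) =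
    size bads.
  rewrite size_flatten /shape -map_comp sumnE big_map big_filter.
  rewrite big_mkord; apply: eq_bigr => j _ /=.
  by rewrite size_allpairs size_iota.
rewrite -size_cat -{1}(size_enum_ord q) -(size_allpairs cons).
apply: uniq_leq_size.
  apply: allpairs_uniq; rewrite ?enum_uniq ?sparse_words_uniq //.
  by move=> [? ?] [? ?] _ _ [-> ->].
move=> _ /allpairsP [[x w] /= [_ + ->]].
rewrite mem_sparse_words => /andP [/eqP szw /asboolP sw].
rewrite mem_cat orbC; case: (boolP (_ \in bads)) => //= /negP notbad.
(* A repetition that starts after the new letter lies inside the sparse word [w], so only [i = 0]
   needs work. *)
rewrite mem_sparse_words /= szw eqxx; apply/asboolP => j [|i] t jr tE /=; last first.
  by rewrite addSn ltnS; exact: sw.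
rewrite add0n ltnS szw => szt eq_take; apply: notbad.
have t0 : 0 < t by case/andP: tE.
apply/flattenP; exists (bad j).
  by apply: map_f; rewrite mem_filter mem_index_iota; apply/andP; split; lia.
rewrite (@period_consK x0 t (E j).+1 (x :: w) t0 _ eq_take) /= ?szw; last by lia.
rewrite -iterS; apply: allpairs_f; first by rewrite mem_iota; lia.
rewrite mem_sparse_words size_drop szw eqxx; apply/asboolP.
exact: sparse_drop.
Qed.

(* The repetitions of single letters cost [E 1] letters each time, those of
   windows of length [(E j).+1] cost at most one letter for each [j > 0]. *)
Lemma sparse_words_growth (x0 : 'I_q) b m :
  E 0 = 0 -> (forall j, 0 < j < r -> E j.+1 <= b ^ E j) ->
  E 1 + b + r.-1 <= q -> b * size (sparse_words m) <= size (sparse_words m.+1).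
Proof.
move=> E0 Eb ltq; elim/ltn_ind: m => m IHm.
set N := fun m => size (sparse_words m) in IHm *.
have decay k : k <= m -> b ^ k * N (m - k) <= N m.
  elim: k => [|k IHk] km; first by rewrite subn0 mul1n.
  apply: leq_trans (IHk (ltnW km)); rewrite expnS -mulnA mulnCA leq_mul2l.
  by have -> : m - k = (m - k.+1).+1; [lia | rewrite IHm ?orbT //; lia].
(* For [j > 0], [decay] absorbs the factor [E j.+1 <= b ^ E j]; for [j = 0] the full [E 1] remains,
   as [E 0 = 0]. *)
have bound : \sum_(j < r | E j <= m) E j.+1 * N (m - E j) <= (E 1 + r.-1) * N m.
  case: r Eb => [|r' Eb]; first by rewrite big_ord0.
  rewrite big_mkcond big_ord_recl /= E0 leq0n subn0 mulnDl leq_add2l.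
  rewrite -[leqRHS](_ : \sum_(i < r') N m = _); last by rewrite sum_nat_const card_ord.
  apply: leq_sum => j _; case: ifP => // jm.
  apply: leq_trans (decay _ jm); rewrite leq_mul2r Eb ?orbT //.
  by rewrite /bump /=; have := ltn_ord j; lia.
have := leq_trans (sparse_words_rec x0 m) (leq_add (leqnn _) bound).
rewrite -!/(N _) => rec; have := leq_mul ltq (leqnn (N m)).
by rewrite !mulnDl in rec bound *; lia.
Qed.

End Count.

(** The value 0 at index 0 makes the windows for [j = 0] single letters; [a] plays the role of
    [E 1]. *)
Definition towers (b a j : nat) : nat :=
  if j is i.+1 then iter i (expn b) a else 0.

Lemma tower_lt_zimin_f n q a b :
  0 < b -> 0 < n -> a + b + n.-2 <= q -> towers b a n.-1 < zimin_f n q.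
Proof.
case: n => // r b0 _ ltq; rewrite /=.
have q0 : 0 < q by lia.
pose x0 := Ordinal q0; set E := towers b a.
have Eb j : 0 < j < r -> E j.+1 <= b ^ E j by case: j.
have grow m : b ^ m <= size (sparse_words q r E m).
  elim: m => [|m IHm].
    have : [::] \in sparse_words q r E 0.
      by rewrite mem_sparse_words; apply/asboolP => j i t _ _; rewrite ltn0.
    by case: sparse_words.
  have /(leq_trans _) := @sparse_words_growth q r E x0 b m erefl Eb ltq.
  by apply; rewrite expnS leq_mul2l IHm orbT.
rewrite /zimin_f; case: ex_minnP => N /asboolP forced _; rewrite ltnNge.
apply/negP => leN.
have : 0 < size (sparse_words q r E N) by apply: leq_trans (grow N); rewrite expn_gt0 b0.
case def_l : sparse_words => [//|w l] _.
have : w \in sparse_words q r E N by rewrite def_l mem_head.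
rewrite mem_sparse_words => /andP [/eqP szw /asboolP sw].
(* The copy found in [w] is longer than [E r], yet [w] has length [N <= E r]. *)
have [h [h0 hw]] := forced w szw.
have := zimin_copy_size (erefl : E 0 = 0) sw (leqnn r) h0 hw.
by have := size_infix hw; rewrite szw; lia.
Qed.

(** * Real towers of base [q] *)

Local Open Scope classical_set_scope.
Local Open Scope ring_scope.

Lemma cvg_sqrt_ln (R : realType) : Num.sqrt (ln q%:R : R) @[q --> \oo] --> +oo.
Proof.
apply/cvgryPge => A; near=> q.
have leq : expR (A ^+ 2) <= q%:R :> R by near: q; exact: nbhs_infty_ger.
apply: le_trans (ler_norm A) _; rewrite -sqrtr_sqr ler_wsqrtr //.
by rewrite -[leLHS]expRK ler_ln ?posrE ?expR_gt0 //; apply: lt_le_trans leq; exact: expR_gt0.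
Unshelve. all: by end_near. Qed.

(** With [y = sqrt (ln q)]: [q * expR (- y)] pays for the letters reserved for [b], [q / y] for the
    smaller base [b] under the top exponent, and [n] for rounding and the [n - 2] lost letters. *)
Definition loss (R : realType) (n q : nat) : R :=
  q%:R * (expR (- Num.sqrt (ln q%:R)) + (Num.sqrt (ln q%:R))^-1) + n%:R.

Lemma loss_ge0 (R : realType) n q : 0 <= loss R n q.
Proof.
by rewrite addr_ge0 // mulr_ge0 // addr_ge0 ?expR_ge0 ?invr_ge0 ?sqrtr_ge0.
Qed.

Lemma cvg_loss (R : realType) n : loss R n q / q%:R @[q --> \oo] --> (0 : R).
Proof.
have sqrtV : (Num.sqrt (ln q%:R : R))^-1 @[q --> \oo] --> (0 : R).
  apply/gtr0_cvgV0; last exact: cvg_sqrt_ln.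
  by move/cvgryPgt: (@cvg_sqrt_ln R); exact.
have exp0 : expR (- Num.sqrt (ln q%:R : R)) @[q --> \oo] --> (0 : R).
  exact: cvg_comp (@cvg_sqrt_ln R) (@cvgr_expR R).
have V0 : (q%:R : R)^-1 @[q --> \oo] --> (0 : R).
  apply/gtr0_cvgV0; last exact: cvgr_idn.
  by move/cvgryPgt: (@cvgr_idn R); exact.
have : expR (- Num.sqrt (ln q%:R : R)) + (Num.sqrt (ln q%:R : R))^-1 +
    n%:R * q%:R^-1 @[q --> \oo] --> (0 + 0 + n%:R * 0 : R).
  by apply: cvgD; [exact: cvgD | apply: cvgMr].
rewrite mulr0 !addr0; apply: cvg_trans; apply: near_eq_cvg; near=> q.
have q0 : q%:R != 0 :> R by rewrite pnatr_eq0 -lt0n; near: q; exact: nbhs_infty_gt.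
by rewrite /loss mulrDl [q%:R * _]mulrC mulfK.
Unshelve. all: by end_near. Qed.

(** The induction carries a spare factor 4. If [1 <= s] and [4 * s <= t], then [4 * q ^ s <= q ^ (2
    * s) <= b ^ (4 * s) <= b ^ t], so the smaller base costs nothing above the first level. *)
Lemma tw_le_towers (R : realType) (q b a j : nat) (x : R) :
  4 <= q%:R :> R -> q%:R <= b%:R ^+ 2 :> R -> 0 <= x ->
  q%:R `^ (x + 1) <= b%:R `^ a%:R ->
  tw q%:R j.+2 x <= (towers b a j.+2)%:R.
Proof.
move=> q4 qb x0 base; rewrite /tw /=.
set S := fun i => iter i (powR q%:R) x.
set T := fun i => iter i (expn b) a.
suff [] : 0 <= S j.+1 /\ 4 * S j.+1 <= (T j.+1)%:R by rewrite /S /T /=; lra.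
have b0 : 0 <= b%:R :> R by [].
have q0 : 0 < q%:R :> R by lra.
have pow4 y z : 0 <= y -> y + 1 <= z -> 4 * q%:R `^ y <= q%:R `^ z :> R.
  move=> y0 yz; apply: (@le_trans _ _ (q%:R `^ (y + 1))); last by rewrite ler_powR //; lra.
  rewrite powRD; last by rewrite (gt_eqF q0) implybT.
  by rewrite powRr1 ?(ltW q0) // mulrC; apply: ler_wpM2l; rewrite ?powR_ge0.
have towS i : (T i.+1)%:R = b%:R `^ (T i)%:R :> R by rewrite /T iterS natrX powR_mulrn.
elim: j => [|j [Sj ST]].
  split; first exact: powR_ge0.
  by rewrite towS; apply: le_trans base; exact: pow4.
split; first exact: powR_ge0.
have S1 : 1 <= S j.+1.
  rewrite [S _]/= -{1}(powRr0 q%:R) ler_powR //; first lra.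
  by rewrite -/(S j); case: (j) => //= ?; exact: powR_ge0.
rewrite towS (_ : S j.+2 = q%:R `^ S j.+1) //.
move: (S j.+1) (T j.+1) S1 ST => s t s1 st.
apply: (@le_trans _ _ (q%:R `^ (2 * s))); first by apply: pow4; lra.
apply: (@le_trans _ _ ((b%:R ^+ 2) `^ (2 * s))).
  by rewrite ge0_ler_powR ?nnegrE ?exprn_ge0 //; lra.
rewrite -powR_mulrn // -powRrM ler_powR //; last lra.
by rewrite -(@ler_pXn2r _ 2) ?nnegrE // expr1n; lra.
Qed.

Lemma tw_le_zimin_f (R : realType) (j q : nat) :
  2 <= Num.sqrt (ln q%:R) :> R -> 4 <= q%:R :> R ->
  loss R j.+3 q <= q%:R ->
  tw q%:R j.+2 (q%:R - loss R j.+3 q) <= (zimin_f j.+3 q)%:R.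
Proof.
set y := Num.sqrt _ => y2 q4 lossq; have q0 : 0 < q%:R :> R by lra.
have lnq : ln q%:R = y ^+ 2.
  by rewrite sqr_sqrtr // ln_ge0; lra.
have qE : q%:R = expR (y ^+ 2) by rewrite -lnq lnK.
set c := q%:R * expR (- y).
have c0 : 0 < c by rewrite mulr_gt0 ?expR_gt0.
set b := (Num.trunc c).+1.
have bc : c <= b%:R by apply: ltW; exact: truncnS_gt.
have cb : b%:R <= c + 1 by rewrite /b -natr1 lerD2r truncn_le ltW.
have b0 : 0 < b%:R :> R by [].
have lossE : loss R j.+3 q = c + q%:R / y + j.+3%:R by rewrite /loss mulrDr.
have qy0 : 0 <= q%:R / y by rewrite divr_ge0 //; lra.
have j3 : j.+3%:R = j.+1%:R + 2 :> R by rewrite -natrD addn2.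
have bjq : (b + j.+1 <= q)%N by rewrite -(ler_nat R) natrD; lra.
(* The largest [a] that [tower_lt_zimin_f] admits. *)
set a := (q - (b + j.+1))%N.
have aE : a%:R = q%:R - b%:R - j.+1%:R :> R by rewrite natrB // natrD opprD addrA.
have lnb : y ^+ 2 - y <= ln b%:R.
  rewrite -[leLHS]expRK ler_ln ?posrE ?expR_gt0 //.
  by rewrite expRD -qE.
have towlt : (towers b a j.+2 < zimin_f j.+3 q)%N.
  by apply: tower_lt_zimin_f => //=; rewrite /a; lia.
apply: le_trans (_ : (towers b a j.+2)%:R <= _); last by rewrite ler_nat ltnW.
apply: tw_le_towers => //.
(* Here [c ^ 2 = expR (2 * y ^ 2 - 2 * y)], at least [q = expR (y ^ 2)] because [y >= 2]. *)
- apply: (@le_trans _ _ (c ^+ 2)).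
    rewrite /c qE -expRD -expRM_natl ler_expR; nra.
  by rewrite ler_pXn2r ?nnegrE //; lra.
- by lra.
rewrite /powR !gt_eqF // ler_expR lnq.
apply: (@le_trans _ _ (a%:R * (y ^+ 2 - y))); last by rewrite ler_wpM2l.
(* The summand [q / y] of the loss, times [y ^ 2], is the [q * y] by which [ln b >= y ^ 2 - y] may
   fall short. *)
have -> : (q%:R - loss R j.+3 q + 1) * y ^+ 2 =
    (q%:R - c - j.+2%:R) * (y ^+ 2 - y) - y * (c + j.+2%:R).
  by rewrite lossE -!natr1; field; lra.
have a_ge : q%:R - c - j.+2%:R <= a%:R by rewrite aE -(natr1 j.+1); lra.
have y0 : 0 <= y by lra.
have A : 0 <= y * (c + j.+2%:R) by rewrite mulr_ge0 // addr_ge0 // ltW.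
have B : 0 <= y ^+ 2 - y by nra.
have := ler_wpM2r B a_ge; lra.
Qed.

Theorem theorem1p1 (R : realType) (n : nat) (hn : (3 <= n)%N) :
  exists g : nat -> R,
    [/\ forall q : nat, 0 <= g q,
        g q / q%:R @[q --> \oo] --> (0 : R) &
        \forall q \near \oo, tw q%:R n.-1 (q%:R - g q) <= (zimin_f n q)%:R].
Proof.
case: n hn => [|[|[|j]]] // _; exists (loss R j.+3); split.
- exact: loss_ge0.
- exact: cvg_loss.
near=> q; have q4 : 4 <= q%:R :> R by near: q; exact: nbhs_infty_ger.
apply: tw_le_zimin_f => //.
  by near: q; move/cvgryPge: (@cvg_sqrt_ln R); exact.
have q0 : 0 < q%:R :> R by lra.
rewrite -[leRHS]mul1r -ler_pdivrMr //; near: q.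
by move/cvgr_le: (@cvg_loss R j.+3); apply.
Unshelve. all: by end_near. Qed.
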